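(* If a digraph $G$ is weightable, then it admits a weighting that is $\{0,1\}$-valued.
   Context: A digraph is a finite directed graph without loops or parallel edges (directed cycles of length two are permitted). A weighting of a digraph $G$ is a map $w:E(G)\to\mathbb{R}$ such that $\sum_{e\in E(C)}w(e)=1$ for every directed cycle $C$ of $G$. $G$ is weightable if it admits a weighting. *)

(* Defs.v *)
From mathcomp Require Import all_boot all_order all_algebra.
From mathcomp Require Import reals.

Set Implicit Arguments.
Unset Strict Implicit.
Unset Printing Implicit Defensive.

Import GRing.Theory.
Local Open Scope ring_scope.

(* Encoding edges by a relation excludes parallel edges; antiparallel pairs
   [adj x y], [adj y x] are allowed. *)
Record digraph := Digraph {
  vertex :> finType;
  adj : rel vertex;
  adj_irrefl : irreflexive adj
}.

Definition edge (G : digraph) := {p : G * G | adj p.1 p.2}.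

(* A directed cycle is given by the cyclic sequence of its distinct vertices;
   [ucycle] also accepts [::], which has to be excluded. Length one is
   impossible since [adj] is irreflexive. *)
Definition dicycle (G : digraph) (c : seq G) : Prop :=
  c <> [::] /\ ucycle (@adj G) c.

Definition cycle_edges (G : digraph) (c : seq G) : {set edge G} :=
  [set a : edge G | val a \in [seq (x, next c x) | x <- c]].

Definition weighting (R : realType) (G : digraph) (w : edge G -> R) : Prop :=
  forall c : seq G, dicycle c -> \sum_(a in cycle_edges c) w a = 1.

Definition weightable (R : realType) (G : digraph) : Prop :=
  exists w : edge G -> R, weighting w.

(* Main.v *)
(* Adding a coboundary [d u - d v] to a weighting gives again a weighting. Every
   closed walk splits into directed cycles, so its weight is a natural number;
   in particular lightest walks exist. In a strong component take for [d] the
   distance from a fixed root: the new weights are nonnegative by the triangle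
   inequality, and integers because each is a difference of weights of two
   closed walks through the root. Every edge of a strong component lies on a
   cycle, whose weight is 1, so the new weights are at most 1. Edges between
   distinct components lie on no cycle and get weight 0. *)

Require Import Defs.
From mathcomp Require Import all_boot all_order all_algebra.
From mathcomp Require Import reals.
From mathcomp Require Import lra.

Set Implicit Arguments.
Unset Strict Implicit.
Unset Printing Implicit Defensive.

Import Order.TTheory GRing.Theory Num.Theory.
Local Open Scope ring_scope.

(** The walk starts at [x] and visits [p] in order, as in [path]; [f] takes all pairs of vertices,
    so no proof of adjacency is carried along. *)
Definition walk_weight (R : nmodType) (T : Type) (f : T -> T -> R) x p : R :=
  \sum_(e <- pairmap f x p) e.

Lemma walk_weight_nil (R : nmodType) (T : Type) (f : T -> T -> R) x :
  walk_weight f x [::] = 0.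
Proof. by rewrite /walk_weight big_nil. Qed.

Lemma walk_weight_cons (R : nmodType) (T : Type) (f : T -> T -> R) x y p :
  walk_weight f x (y :: p) = f x y + walk_weight f y p.
Proof. by rewrite /walk_weight big_cons. Qed.

Lemma walk_weight_cat (R : nmodType) (T : Type) (f : T -> T -> R) x p q :
  walk_weight f x (p ++ q) = walk_weight f x p + walk_weight f (last x p) q.
Proof. by rewrite /walk_weight pairmap_cat big_cat. Qed.

Lemma walk_weight_rcons (R : nmodType) (T : Type) (f : T -> T -> R) x p y :
  walk_weight f x (rcons p y) = walk_weight f x p + f (last x p) y.
Proof.
by rewrite -cats1 walk_weight_cat walk_weight_cons walk_weight_nil addr0.
Qed.

Lemma walk_weight_potential (R : zmodType) (T : Type) (f : T -> T -> R)
    (d : T -> R) x p :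
  walk_weight (fun y z => f y z + d y - d z) x p =
  walk_weight f x p + d x - d (last x p).
Proof.
elim: p x => [|y p IHp] x /=; first by rewrite !walk_weight_nil add0r subrr.
rewrite !walk_weight_cons IHp -!addrA; congr (_ + _).
by rewrite (addrCA (- d y)) addKr addrCA.
Qed.

Lemma sum_next_walk_weight (R : nmodType) (T : eqType) (f : T -> T -> R) x p :
  uniq (x :: p) ->
  \sum_(y <- x :: p) f y (next (x :: p) y) = walk_weight f x (rcons p x).
Proof.
move=> uxp; rewrite /walk_weight -(big_map (fun y => f y _) xpredT id).
congr bigop; apply: (@eq_from_nth _ 0) => [|i].
  by rewrite size_map size_pairmap size_rcons.
rewrite size_map => lti; rewrite (nth_map x) // (nth_pairmap x) ?size_rcons //.
have -> : nth x (x :: rcons p x) i = nth x (x :: p) i.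
  by rewrite -rcons_cons nth_rcons lti.
(* [next] reads entry [i] of [p] with default [x]; at the last index this default is the closing
   vertex. *)
rewrite next_nth mem_nth // index_uniq // nth_rcons; congr (f _ _).
by case: ltnP => // le_pi; rewrite nth_default // if_same.
Qed.

(** The pairs [(x, next c x)] are distinct and adjacent, so [val] matches the edges of the cycle
    with the entries of [c]. *)
Lemma sum_cycle_edges (R : nmodType) (G : digraph) (f : G -> G -> R)
    (c : seq G) : ucycle (@adj G) c ->
  \sum_(a in cycle_edges c) f (val a).1 (val a).2 = \sum_(x <- c) f x (next c x).
Proof.
case/andP=> cc uc.
rewrite -(big_map (fun x => (x, next c x)) xpredT (fun q => f q.1 q.2)).
rewrite big_uniq /=; last by rewrite map_inj_uniq // => x y [].
rewrite (reindex_omap (val : edge G -> G * G) insub) /= => [|q /mapP[x xc ->]].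
  by apply: eq_bigl => a; rewrite inE valK eqxx andbT.
by rewrite insubT /= ?next_cycle.
Qed.

Section Weighting.

Variables (R : realFieldType) (G : digraph) (f : G -> G -> R).
Local Notation e := (@adj G).
Local Notation wt := (walk_weight f).

Hypothesis cycle1 : forall x p, ucycle e (x :: p) -> wt x (rcons p x) = 1.

(** Induction on the walk: if the new first vertex [x] recurs on the shortened tail, the part up to
    that recurrence is a directed cycle and is cut off, at weight 1; [n] counts the cuts. *)
Lemma walk_shorten x p : path e x p -> exists q (n : nat),
  [/\ path e x q, uniq (x :: q), last x q = last x p & wt x p = wt x q + n%:R].
Proof.
elim: p x => [|y p IHp] x /=; first by exists [::], 0%N; rewrite addr0.
case/andP=> exy /IHp[q [n [eq uq lq wq]]].
have [|nxq] := boolP (x \in y :: q); last first.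
  exists (y :: q), n; split=> //; rewrite ?nxq //= ?exy //.
  by rewrite !walk_weight_cons wq addrA.
rewrite inE => /predU1P[xy|xq]; first by rewrite xy adj_irrefl in exy.
case/path.splitP: xq eq uq lq wq => q1 q2.
rewrite cat_path last_rcons -cat_cons cat_uniq last_cat last_rcons.
move=> /andP[eq1 eq2] /and3P[uq1 q12 uq2] lq wq.
exists q2, n.+1; split=> //.
  rewrite /= uq2 andbT; apply: contra q12 => xq2; apply/hasP.
  by exists x; rewrite // inE mem_rcons inE eqxx orbT.
have /cycle1 : ucycle e (x :: y :: q1).
  rewrite /ucycle /cycle rcons_cons /= exy eq1 /=.
  by move: uq1; rewrite -rcons_cons rcons_uniq.
rewrite /= walk_weight_cons => w1.
rewrite walk_weight_cons wq walk_weight_cat last_rcons !addrA w1 (addrC 1).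
by rewrite -addrA nat1r.
Qed.

(** A closed walk shortens to the empty one, so only the cycles cut off contribute. *)
Lemma closed_walk_nat x p :
  path e x p -> last x p = x -> exists n : nat, wt x p = n%:R.
Proof.
move=> /walk_shorten[q [n [_ uq lq ->]]] lp; exists n.
case/lastP: q uq lq => [|q y]; first by rewrite walk_weight_nil add0r.
by rewrite lp last_rcons => /andP[+ _] => /[swap] ->; rewrite mem_rcons mem_head.
Qed.

(** Shortening never increases the weight, even where [f] is negative, so a minimum over the
    finitely many walks of at most [#|G|] steps is a minimum over all. *)
Lemma ex_lightest_walk x y : connect e x y -> exists p,
  [/\ path e x p, last x p = y &
      forall q, path e x q -> last x q = y -> wt x p <= wt x q].
Proof.
pose P (p : #|G|.-bseq G) := path e x p && (last x p == y).
have simple q : path e x q -> last x q = y ->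
    exists2 p, P p & wt x p <= wt x q.
  move=> /walk_shorten[p [n [ep /andP[_ up] lp ->]]] lq.
  have sp : (size p <= #|G|)%N by rewrite -(card_uniqP up) max_card.
  by exists (Bseq sp); rewrite /P /= ?ep ?lp ?lq ?eqxx // lerDl ler0n.
case/connectP=> p0 ep0 /esym/(simple _ ep0)[p Pp _].
case: (arg_minP (fun p : #|G|.-bseq G => wt x p) Pp).
move=> q /andP[eq /eqP lq] minq; exists q; split=> // q' eq' lq'.
by have [p' /minq] := simple _ eq' lq'; apply: le_trans.
Qed.

Lemma ex_nat_potential : exists d : G -> R, forall u v, e u v -> connect e v u ->
  exists n : nat, f u v + d u - d v = n%:R.
Proof.
pose scc u v := connect e u v && connect e v u.
(* The root: [choose] returns the same vertex for every [v] in a strong component. *)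
pose r v := choose (scc v) v.
have rP v : scc v (r v) by apply: chooseP; rewrite /scc connect0.
have walk v : exists p, [/\ path e (r v) p, last (r v) p = v &
    forall q, path e (r v) q -> last (r v) q = v -> wt (r v) p <= wt (r v) q].
  by apply: ex_lightest_walk; case/andP: (rP v).
have [W WP] := fin_all_exists walk.
exists (fun v => wt (r v) (W v)) => u v euv cvu /=.
have ruv : r u = r v.
  have scc_uv : scc u =1 scc v.
    have cuv := connect1 euv.
    move=> z; apply/andP/andP=> -[uz zu].
      by split; [apply: connect_trans cvu uz | apply: connect_trans zu cuv].
    by split; [apply: connect_trans cuv uz | apply: connect_trans zu cvu].
  rewrite /r (eq_choose scc_uv); apply: choose_id; rewrite /scc.
    by rewrite cvu connect1.
  by rewrite connect0.
have [eWu lWu _] := WP u; have [eWv lWv minWv] := WP v.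
rewrite ruv in eWu lWu *.
set Wu := W u in eWu lWu *; set Wv := W v in eWv lWv minWv *.
have eWuv : path e (r v) (rcons Wu v) by rewrite rcons_path eWu lWu.
(* [Wu] followed by the edge competes with the lightest walk [Wv]. *)
have g_ge0 : 0 <= f u v + wt (r v) Wu - wt (r v) Wv.
  have := minWv _ eWuv (last_rcons _ _ _).
  by rewrite walk_weight_rcons lWu; lra.
(* A way back [p] to the root closes both [Wv] and [Wu] followed by the edge; it cancels in the
   difference of their weights. *)
have [p ep lp] : exists2 p, path e v p & r v = last v p.
  by apply/connectP; case/andP: (rP v).
have [|//|m] := @closed_walk_nat (r v) (Wv ++ p).
- by rewrite cat_path eWv lWv.
- by rewrite last_cat lWv.
have [|//|n] := @closed_walk_nat (r v) (rcons Wu v ++ p).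
- by rewrite cat_path eWuv last_rcons.
- by rewrite last_cat last_rcons.
rewrite !walk_weight_cat walk_weight_rcons last_rcons lWu lWv => wn wm.
have le_mn : (m <= n)%N by rewrite -(ler_nat R) -wn -wm; lra.
by exists (n - m)%N; rewrite natrB // -wn -wm; lra.
Qed.

(** A simple path from [v] back to [u] closes the edge to a cycle, whose new weight is still 1; the
    path has nonnegative new weight, so the natural number on the edge is at most 1. *)
Lemma ex_01_potential : exists d : G -> R, forall u v, e u v -> connect e v u ->
  f u v + d u - d v = 0 \/ f u v + d u - d v = 1.
Proof.
have [d dP] := ex_nat_potential; exists d => u v euv cvu.
pose g x y := f x y + d x - d y.
(* A walk whose end reaches its start stays in one strong component, so [dP] applies to each of its
   edges. *)
have g_ge0 p x : path e x p -> connect e (last x p) x ->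
    0 <= walk_weight g x p.
  elim: p x => [|y p IHp] x /=; first by rewrite walk_weight_nil.
  case/andP=> exy ep clx; rewrite walk_weight_cons addr_ge0 //.
    have cyl : connect e y (last y p) by apply/connectP; exists p.
    by rewrite /g; have [n ->] := dP _ _ exy (connect_trans cyl clx).
  by apply: IHp => //; apply: connect_trans clx (connect1 exy).
case/connectP: (cvu) => p0 /shortenP[p ep up _] lp.
have /cycle1 w1 : ucycle e (v :: p) by rewrite /ucycle /= rcons_path ep -lp euv.
have := walk_weight_potential f d v (rcons p v).
rewrite walk_weight_rcons last_rcons addrK w1 -lp.
have : 0 <= walk_weight g v p by rewrite g_ge0 // -lp connect1.
have [n gn] := dP _ _ euv cvu; rewrite -/(g u v) in gn *.
rewrite -/g gn => wp_ge0 wp1.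
have : (n <= 1)%N by rewrite -(ler_nat R); lra.
by case: n {gn wp1} => [|[|]]; [left | right | ].
Qed.

End Weighting.

Theorem mainTheorem6 (R : realType) (G : digraph) :
  weightable R G ->
  exists w : edge G -> R,
    weighting w /\ (forall a : edge G, w a = 0 \/ w a = 1).
Proof.
case=> w0 w0P.
(* [w0] is extended by 0 to non-adjacent pairs, so that it can be summed along vertex sequences. *)
pose f x y := oapp w0 0 (insub (x, y) : option (edge G)).
have w0E a : w0 a = f (val a).1 (val a).2 by rewrite /f -surjective_pairing valK.
have cycle1 x p : ucycle (@adj G) (x :: p) -> walk_weight f x (rcons p x) = 1.
  move=> xpP; have [_ uxp] := andP xpP.
  have <- : \sum_(a in cycle_edges (x :: p)) w0 a = 1 by apply: w0P; split.
  rewrite -sum_next_walk_weight // -(sum_cycle_edges _ xpP).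
  by apply: eq_bigr => a _.
have [d dP] := ex_01_potential cycle1.
pose g x y := if connect (@adj G) y x then f x y + d x - d y else 0.
exists (fun a => g (val a).1 (val a).2); split=> [[|x p] [] // _ xpP | a].
  rewrite (sum_cycle_edges _ xpP); have [cxp uxp] := andP xpP.
  (* Vertices of a cycle reach each other, so the test in [g] succeeds on all its edges. *)
  under eq_big_seq => y yxp.
    rewrite /g (connect_cycle cxp) ?mem_next //; over.
  rewrite (sum_next_walk_weight (fun y z => f y z + d y - d z) uxp).
  by rewrite walk_weight_potential last_rcons addrK cycle1.
rewrite /g; case: ifP => [cyx|_]; last by left.
exact: dP (valP a) cyx.
Qed.
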